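(* Let $\ell\ge3$ be a prime and $t=2$. Then $\mu_\ell(X_2,\alpha)=0$ for all $\alpha\in\mathbb{Z}_\ell^2\setminus(\ell\mathbb{Z}_\ell)^2$. If $\ell\equiv3\pmod 4$, then $\lambda_\ell(X_2,\alpha)=1$ for all such $\alpha$. If $\ell\equiv1\pmod4$, then $$\mathrm{Prob}_\ell(X_2;\mu=0,\lambda=\lambda_0)=\begin{cases}\frac{\ell-1}{\ell+1}&\text{if }\lambda_0=1,\\ \frac{2}{\ell+1}&\text{if }\lambda_0=3,\\ 0&\text{otherwise.}\end{cases}$$
   Context: For $b\in\mathbb{Z}_\ell$ put $\binom{b}{n}=\frac{b(b-1)\cdots(b-n+1)}{n!}\in\mathbb{Z}_\ell$ and $(1+T)^b=\sum_{n\ge0}\binom{b}{n}T^n\in\mathbb{Z}_\ell[[T]]$. The bouquet $X_t$ is the multigraph with one vertex and $t$ undirected loops; a vector $\alpha=(\alpha_1,\dots,\alpha_t)\in\mathbb{Z}_\ell^t$ assigns the voltage $\alpha_j$ to the $j$-th loop. It is admissible if $\alpha\in\mathbb{Z}_\ell^t\setminus(\ell\mathbb{Z}_\ell)^t$. The characteristic series is $$f(T)=f_{X_t,\alpha}(T)=\sum_{j=1}^t\big(2-(1+T)^{\alpha_j}-(1+T)^{-\alpha_j}\big)\in\mathbb{Z}_\ell[[T]].$$ For admissible $\alpha$ it is nonzero, and it has zero constant term. By Weierstrass preparation write $f(T)=\ell^{\mu}g(T)u(T)$ with $\mu\in\mathbb{Z}_{\ge0}$, $g$ a distinguished polynomial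 (monic, all non-leading coefficients divisible by $\ell$) and $u\in\mathbb{Z}_\ell[[T]]^\times$. Then $\mu_\ell(X_t,\alpha):=\mu$ and $\lambda_\ell(X_t,\alpha):=\deg g-1$ (note the shift by $-1$). Let $\tau$ be the Haar measure on $\mathbb{Z}_\ell^t$ normalized by $\tau(\mathbb{Z}_\ell^t)=1$, so $\tau(\mathbb{Z}_\ell^t\setminus(\ell\mathbb{Z}_\ell)^t)=1-\ell^{-t}$. Define $$\mathrm{Prob}_\ell(X_t;\mu=\mu_0,\lambda=\lambda_0)=(1-\ell^{-t})^{-1}\,\tau\big(\{\alpha\in\mathbb{Z}_\ell^t\setminus(\ell\mathbb{Z}_\ell)^t:\mu_\ell(X_t,\alpha)=\mu_0,\ \lambda_\ell(X_t,\alpha)=\lambda_0\}\big).$$ *)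

(* Defs.v *)
From HB Require Import structures.
From mathcomp Require Import all_boot all_order all_algebra.
From mathcomp Require Import all_classical all_reals all_analysis.

Set Implicit Arguments.
Unset Strict Implicit.
Unset Printing Implicit Defensive.

Import Order.TTheory GRing.Theory Num.Theory.

Local Open Scope classical_set_scope.
Local Open Scope ring_scope.

(* Z_l is the inverse limit of the rings Z/l^(n+1), n >= 0.  The exponent is
   n.+1 because 'Z_m is Z/m only for m > 1.  The ring structure exists for
   every l; it is the ring of l-adic integers when l is prime. *)
Record padic (l : nat) := Padic {
  zproj : forall n : nat, 'Z_(l ^ n.+1);
  zprojP : forall n, (zproj n.+1 : nat)%:R = zproj n :> 'Z_(l ^ n.+1) }.

Lemma padicP l (x y : padic l) : (forall n, zproj x n = zproj y n) -> x = y.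
Proof.
case: x y => [x xP] [y yP] /= e.
have {}e : x = y by apply: functional_extensionality_dep.
by rewrite -e in yP *; congr Padic; apply: Prop_irrelevance.
Qed.

HB.instance Definition _ l := gen_eqMixin (padic l).
HB.instance Definition _ l := gen_choiceMixin (padic l).

Section PadicRing.
Variable l : nat.
Implicit Types x y z : padic l.

Definition zred n (a : 'Z_(l ^ n.+2)) : 'Z_(l ^ n.+1) := (a : nat)%:R.

Lemma zred_natr n k : zred (k%:R : 'Z_(l ^ n.+2)) = k%:R.
Proof.
rewrite /zred !Zp_nat; apply: val_inj => /=; rewrite modn_dvdm //.
case: l => [|[|m]]; rewrite ?exp0n ?exp1n //.
by rewrite !Zp_cast ?dvdn_exp2l // -[1%N]/(m.+2 ^ 0)%N ltn_exp2l.
Qed.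

Lemma zredD n : {morph @zred n : a b / a + b}.
Proof.
by move=> a b; rewrite -[a in LHS]natr_Zp -[b in LHS]natr_Zp -natrD zred_natr
  natrD.
Qed.

Lemma zredM n : {morph @zred n : a b / a * b}.
Proof.
by move=> a b; rewrite -[a in LHS]natr_Zp -[b in LHS]natr_Zp -natrM zred_natr
  natrM.
Qed.

Lemma zredN n : {morph @zred n : a / - a}.
Proof.
move=> a; apply: (addIr (zred a)); rewrite -zredD !addNr.
exact: (zred_natr n 0).
Qed.

Lemma zred_proj x n : zred (zproj x n.+1) = zproj x n.
Proof. exact: zprojP. Qed.

Definition padic_nat k : padic l :=
  Padic (zproj := fun n => k%:R) (fun n => zred_natr n k).

Lemma padic_opp_subproof x n : zred (- zproj x n.+1) = - zproj x n.
Proof. by rewrite zredN zred_proj. Qed.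
Definition padic_opp x : padic l :=
  Padic (zproj := fun n => - zproj x n) (padic_opp_subproof x).

Lemma padic_add_subproof x y n :
  zred (zproj x n.+1 + zproj y n.+1) = zproj x n + zproj y n.
Proof. by rewrite zredD !zred_proj. Qed.
Definition padic_add x y : padic l :=
  Padic (zproj := fun n => zproj x n + zproj y n) (padic_add_subproof x y).

Lemma padic_mul_subproof x y n :
  zred (zproj x n.+1 * zproj y n.+1) = zproj x n * zproj y n.
Proof. by rewrite zredM !zred_proj. Qed.
Definition padic_mul x y : padic l :=
  Padic (zproj := fun n => zproj x n * zproj y n) (padic_mul_subproof x y).

Fact padic_addA : associative padic_add.
Proof. by move=> x y z; apply: padicP => n /=; rewrite addrA. Qed.
Fact padic_addC : commutative padic_add.
Proof. by move=> x y; apply: padicP => n /=; rewrite addrC. Qed.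
Fact padic_add0 : left_id (padic_nat 0) padic_add.
Proof. by move=> x; apply: padicP => n /=; rewrite add0r. Qed.
Fact padic_addN : left_inverse (padic_nat 0) padic_opp padic_add.
Proof. by move=> x; apply: padicP => n /=; rewrite addNr. Qed.
HB.instance Definition _ :=
  GRing.isZmodule.Build (padic l) padic_addA padic_addC padic_add0 padic_addN.

Fact padic_mulA : associative padic_mul.
Proof. by move=> x y z; apply: padicP => n /=; rewrite mulrA. Qed.
Fact padic_mulC : commutative padic_mul.
Proof. by move=> x y; apply: padicP => n /=; rewrite mulrC. Qed.
Fact padic_mul1 : left_id (padic_nat 1) padic_mul.
Proof. by move=> x; apply: padicP => n /=; rewrite mul1r. Qed.
Fact padic_mulDl : left_distributive padic_mul padic_add.
Proof. by move=> x y z; apply: padicP => n /=; rewrite mulrDl. Qed.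
Fact padic_1neq0 : padic_nat 1 != 0.
Proof.
apply/eqP => /(congr1 (fun x : padic l => zproj x 0)) /= /eqP.
by rewrite oner_eq0.
Qed.
HB.instance Definition _ := GRing.Zmodule_isComNzRing.Build (padic l)
  padic_mulA padic_mulC padic_mul1 padic_mulDl padic_1neq0.

HB.instance Definition _ := isPointed.Build (padic l) 0.

Lemma zproj0 n : zproj (0 : padic l) n = 0. Proof. by []. Qed.
Lemma zproj1 n : zproj (1 : padic l) n = 1. Proof. by []. Qed.
Lemma zprojD x y n : zproj (x + y) n = zproj x n + zproj y n. Proof. by []. Qed.
Lemma zprojN x n : zproj (- x) n = - zproj x n. Proof. by []. Qed.
Lemma zprojM x y n : zproj (x * y) n = zproj x n * zproj y n. Proof. by []. Qed.

Lemma zproj_nat k n : zproj (k%:R : padic l) n = k%:R.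
Proof. by elim: k => // k IH; rewrite -natr1 zprojD IH natr1. Qed.

End PadicRing.

Section PadicTopology.
Variable l : nat.

(* [zproj y n = zproj x n] means y = x modulo l^(n+1). *)
Definition padic_open (A : set (padic l)) : Prop :=
  forall x, A x -> exists n, forall y, zproj y n = zproj x n -> A y.

Lemma zproj_le (x y : padic l) m n : (m <= n)%N ->
  zproj x n = zproj y n -> zproj x m = zproj y m.
Proof.
move=> /subnK <-; elim: (n - m)%N => [//|k IH] /= e.
by apply: IH; rewrite -zred_proj -[RHS]zred_proj e.
Qed.

Fact padic_openT : padic_open setT.
Proof. by move=> x _; exists 0%N. Qed.

Fact padic_openI : setI_closed padic_open.
Proof.
move=> A B oA oB x [/oA[m mA] /oB[n nB]]; exists (maxn m n) => y e; split.
  by apply: mA; apply: zproj_le e; rewrite leq_maxl.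
by apply: nB; apply: zproj_le e; rewrite leq_maxr.
Qed.

Fact padic_open_bigU (I : Type) (A : I -> set (padic l)) :
  (forall i, padic_open (A i)) -> padic_open (\bigcup_i A i).
Proof.
move=> oA x [i _ /oA[n nA]]; exists n => y /nA Ay.
by exists i.
Qed.

HB.instance Definition _ := isOpenTopological.Build (padic l)
  padic_openT padic_openI padic_open_bigU.

End PadicTopology.

(* Z_l^t with its Borel sigma-algebra; the topology on row vectors is the
   product topology. *)
Definition borel_padic (l t : nat) := g_sigma_algebraType (@open 'rV[padic l]_t).

(* The normalisation tau(Z_l^t) = 1 is part of the type [probability]. *)
Definition is_haar (R : realType) (l t : nat)
    (tau : probability (borel_padic l t) R) : Prop :=
  forall (a : 'rV[padic l]_t) (A : set (borel_padic l t)), measurable A ->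
    tau [set a + (x : 'rV[padic l]_t) | x in A] = tau A.

(* A power series is its sequence of coefficients.  The ring multiplication
   that the library puts on functions is pointwise, hence [fps_mul]. *)
Definition fps_mul (A : nzRingType) (f g : nat -> A) : nat -> A :=
  fun n => \sum_(i < n.+1) f i * g (n - i)%N.

Definition fps_unit (A : nzRingType) (u : nat -> A) : Prop :=
  exists v, fps_mul u v = (fun n => (n == 0)%:R).

Section Invariants.
Variable l : nat.

Definition ldvd (x : padic l) : Prop := exists y, x = l%:R * y.

(* [binom b n] is the quotient b (b - 1) ... (b - n + 1) / n!; see [binomP] and
   [binom_uniq]. *)
Definition binom (b : padic l) (n : nat) : padic l :=
  xget 0 [set c | n`!%:R * c = \prod_(i < n) (b - i%:R)].

Definition one_plus_T_pow (b : padic l) : nat -> padic l := binom b.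

Definition char_series t (alpha : 'rV[padic l]_t) : nat -> padic l := fun n =>
  \sum_(j < t) (2 * (n == 0)%:R
                - one_plus_T_pow (alpha ord0 j) n
                - one_plus_T_pow (- alpha ord0 j) n).

Definition admissible t (alpha : 'rV[padic l]_t) : Prop :=
  ~ (forall j, ldvd (alpha ord0 j)).

Definition distinguished (g : {poly padic l}) : Prop :=
  g \is monic /\ forall i, (i < (size g).-1)%N -> ldvd g`_i.

Definition weierstrass (f : nat -> padic l) (mu : nat) (g : {poly padic l})
    (u : nat -> padic l) : Prop :=
  [/\ distinguished g, fps_unit u &
      f = (fun n => l%:R ^+ mu * fps_mul (fun i => g`_i) u n)].

(* The pair (mu, g) of the Weierstrass factorisation of f, which is unique for
   l prime and f <> 0.  The default is reached only when there is no such
   factorisation (f = 0); it has mu = 1 and deg g = 0, so that no statement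
   "mu = 0" or "deg g = d", d > 0, can hold for want of a factorisation. *)
Definition weierstrass_data (f : nat -> padic l) : nat * {poly padic l} :=
  xget (1%N, 1) [set p | exists u, weierstrass f p.1 p.2 u].

Definition mu_inv t (alpha : 'rV[padic l]_t) : nat :=
  (weierstrass_data (char_series alpha)).1.

Definition lambda_inv t (alpha : 'rV[padic l]_t) : int :=
  ((size (weierstrass_data (char_series alpha)).2).-1)%:Z - 1.

Definition Prob (R : realType) t (tau : probability (borel_padic l t) R)
    (mu0 : nat) (lambda0 : int) : R :=
  (1 - (l%:R ^+ t)^-1)^-1 *
  fine (tau [set alpha : 'rV[padic l]_t |
    [/\ admissible alpha, mu_inv alpha = mu0 & lambda_inv alpha = lambda0]]).

End Invariants.

Section Binomial.
Variables (l : nat) (l_prime : prime l).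

Lemma expl_gt1 n : (1 < l ^ n.+1)%N.
Proof.
by rewrite -[1%N]/(l ^ 0)%N ltn_exp2l // prime_gt1.
Qed.

Lemma natr_ffact (A : nzRingType) (k n : nat) :
  (k ^_ n)%:R = \prod_(i < n) (k%:R - i%:R) :> A.
Proof.
elim: n => [|n IH]; first by rewrite ffactn0 big_ord0.
rewrite ffactnSr natrM IH big_ord_recr /=.
have [le|lt] := leqP n k; first by rewrite natrB.
have /eqP : (k ^_ n)%:R = 0 :> A by rewrite ffact_small.
by rewrite IH => /eqP ->; rewrite !mul0r.
Qed.

Lemma eq_Znat m (lm : (1 < m)%N) (a b : nat) :
  (a%:R = b%:R :> 'Z_m) <-> (a = b %[mod m])%N.
Proof.
split=> [/(congr1 (@nat_of_ord _))|e]; first by rewrite !val_Zp_nat.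
by apply: val_inj; rewrite /= !val_Zp_nat.
Qed.

Lemma fact_cancel k n (a b : nat) :
  (n`! * a = n`! * b %[mod l ^ (k + logn l n`!)])%N -> (a = b %[mod l ^ k])%N.
Proof.
wlog ab : a b / (b <= a)%N => [W e|].
  by have [/W|/ltnW /W W'] := leqP b a; [apply | apply/esym/W'/esym].
move=> /eqP; rewrite !eqn_mod_dvd ?leq_mul2l ?ab ?orbT // -mulnBr => d.
apply/eqP; rewrite eqn_mod_dvd //.
have f0 := fact_gt0 n.
have fE := partnC l f0; move: d; rewrite -{2}fE p_part expnD.
rewrite mulnC -!mulnA dvdn_pmul2l ?expn_gt0 ?prime_gt0 // Gauss_dvdr //.
by rewrite coprimeXl // prime_coprime // -p'natE // part_pnat.
Qed.

Lemma zproj_nat_le (b : padic l) m n : (m <= n)%N ->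
  (zproj b n : nat)%:R = zproj b m :> 'Z_(l ^ m.+1).
Proof.
move=> mn; rewrite -zproj_nat; transitivity (zproj b m) => //.
by apply: (zproj_le mn); rewrite zproj_nat natr_Zp.
Qed.

Lemma ffact_proj (b : padic l) n m k : (m <= k)%N ->
  (zproj b k ^_ n)%:R = \prod_(i < n) (zproj b m - i%:R) :> 'Z_(l ^ m.+1).
Proof. by move=> mk; rewrite natr_ffact zproj_nat_le. Qed.

Lemma binom_ex (b : padic l) (n : nat) :
  exists c : padic l, n`!%:R * c = \prod_(i < n) (b - i%:R).
Proof.
set v := logn l n`!.
pose c k : 'Z_(l ^ k.+1) := 'C(zproj b (k + v), n)%:R.
have cP k : (c k.+1 : nat)%:R = c k.
  rewrite -[LHS]/(zred (c k.+1)) zred_natr; apply/(eq_Znat (expl_gt1 k)).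
  apply: (@fact_cancel _ n); rewrite ![(n`! * _)%N]mulnC !bin_ffact -/v addSn.
  by apply/(eq_Znat (expl_gt1 _)); rewrite !(@ffact_proj _ _ (k + v)%N) // addSn.
exists (Padic cP); apply: padicP => k.
rewrite zprojM zproj_nat /= -natrM mulnC bin_ffact (ffact_proj _ _ (leq_addr v k)).
rewrite (big_morph (fun x : padic l => zproj x k)
  (fun x y => zprojM x y k) (zproj1 l k)).
by apply: eq_bigr => i _; rewrite zprojD zprojN zproj_nat.
Qed.

Lemma binom_uniq (n : nat) (c c' : padic l) :
  n`!%:R * c = n`!%:R * c' -> c = c'.
Proof.
move=> e; apply: padicP => k; set m := (k + logn l n`!)%N.
have : zproj (n`!%:R * c) m = zproj (n`!%:R * c') m by rewrite e.
rewrite !zprojM !zproj_nat -[zproj c m]natr_Zp -[zproj c' m]natr_Zp -!natrM.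
move/(eq_Znat (expl_gt1 m)); rewrite /m => /(@fact_cancel k.+1).
by move/(eq_Znat (expl_gt1 k)); rewrite !zproj_nat_le ?leq_addr.
Qed.

Lemma binomP (b : padic l) (n : nat) :
  n`!%:R * binom b n = \prod_(i < n) (b - i%:R).
Proof.
by have := xgetPex (0 : padic l) (binom_ex b n).
Qed.

End Binomial.

(* Main.v *)
(* With s = a^2 + b^2, the coefficients of f in degrees 0, 1, 2, 3 are
   0, 0, -s, s, and 12 f_4 = -(a^4 + b^4) - 11 s.  If l does not divide s, the
   first unit coefficient of f has index 2; if l divides s and (a, b) is not 0
   mod l, then a^4 + b^4 = 2 a^4 mod l and the first unit coefficient has index
   4.  This index is the degree of the distinguished polynomial, so lambda is 1
   or 3, and which of the two depends on (a, b) mod l only.  Haar measure is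
   uniform on residue classes, and a^2 + b^2 = 0 has 2 (l - 1) nonzero solutions
   in F_l when -1 is a square, none otherwise. *)
From HB Require Import structures.
Require Import Defs.
From mathcomp Require Import all_boot all_order all_algebra all_field ring.
From mathcomp Require Import all_classical all_reals all_analysis.

Set Implicit Arguments.
Unset Strict Implicit.
Unset Printing Implicit Defensive.

Import Order.TTheory GRing.Theory Num.Theory.

Local Open Scope classical_set_scope.
Local Open Scope ring_scope.

(** * Reduction modulo [l], and completeness of the [l]-adic integers *)

Section Residue.
Variables (l : nat) (l_prime : prime l).
Implicit Types x y z : padic l.

(* The unused proof makes [red] a ring morphism without further hypotheses. *)
Definition red (_ : prime l) x : 'F_l := (zproj x 0 : nat)%:R.

(** ['F_l] is built on [pdiv l], so it is a different type from ['Z_(l ^ 1)]; numerals are the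
    bridge between the two. *)
Lemma Zp_Fp_natr k : ((k%:R : 'Z_(l ^ 1)) : nat)%:R = k%:R :> 'F_l.
Proof. by rewrite val_Zp_nat ?expl_gt1 // expn1 Fp_nat_mod. Qed.

Lemma redD : {morph red l_prime : x y / x + y}.
Proof.
move=> x y; rewrite /red zprojD -natrD -[RHS]Zp_Fp_natr natrD.
by rewrite !natr_Zp.
Qed.

Lemma redM : {morph red l_prime : x y / x * y}.
Proof.
move=> x y; rewrite /red zprojM -natrM -[RHS]Zp_Fp_natr natrM.
by rewrite !natr_Zp.
Qed.

Lemma red0 : red l_prime 0 = 0.
Proof. by rewrite /red zproj0 (Zp_Fp_natr 0). Qed.

Lemma red1 : red l_prime 1 = 1.
Proof. by rewrite /red zproj1 (Zp_Fp_natr 1). Qed.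

HB.instance Definition _ := GRing.isNmodMorphism.Build (padic l) 'F_l
  (red l_prime) (conj red0 redD).
HB.instance Definition _ := GRing.isMonoidMorphism.Build (padic l) 'F_l
  (red l_prime) (conj red1 redM).

Lemma zproj_red x y : zproj x 0 = zproj y 0 <-> red l_prime x = red l_prime y.
Proof.
split=> [e|]; first by rewrite /red e.
move/(congr1 (@nat_of_ord _)); rewrite !val_Fp_nat //.
have lt z : (zproj z 0 < l)%N.
  by rewrite (leq_trans (ltn_ord _)) // Zp_cast ?expl_gt1 // expn1.
by rewrite !modn_small //; apply: val_inj.
Qed.

Lemma eqn_mod_expS m (a b : nat) :
  (l * a = l * b %[mod l ^ m.+1])%N <-> (a = b %[mod l ^ m])%N.
Proof.
rewrite expnS -!muln_modr; split=> [/eqP|-> //].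
by rewrite eqn_pmul2l ?prime_gt0 // => /eqP.
Qed.

(** Multiplication by [l] gains one level of precision; this makes the map used in Weierstrass
    preparation a contraction. *)
Lemma zproj_natl m x y :
  zproj x m = zproj y m -> zproj (l%:R * x) m.+1 = zproj (l%:R * y) m.+1.
Proof.
move=> e; rewrite !zprojM zproj_nat -[zproj x _]natr_Zp -[zproj y _]natr_Zp.
rewrite -!natrM; apply/(eq_Znat (expl_gt1 l_prime _))/eqn_mod_expS.
by apply/(eq_Znat (expl_gt1 l_prime _)); rewrite !zproj_nat_le.
Qed.

Lemma zproj_natl0 x : zproj (l%:R * x) 0 = 0.
Proof.
apply/(zproj_red _ 0); rewrite rmorphM rmorph_nat rmorph0.
by rewrite (pcharf0 (pchar_Fp l_prime)) mul0r.
Qed.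

Lemma ldvdP x : ldvd x <-> red l_prime x = 0.
Proof.
split=> [[y ->]|].
  by rewrite -(rmorph0 (red l_prime)) -zproj_red zproj_natl0.
move=> x0.
(* Division by [l] loses one level, so level [m] of the quotient is read off level [m.+1] of [x]. *)
pose y m : 'Z_(l ^ m.+1) := (zproj x m.+1 %/ l)%:R.
have dv m : (l %| zproj x m)%N.
  have := zproj_nat_le x (leq0n m).
  have -> : zproj x 0 = 0 by rewrite -(zproj0 l 0) zproj_red x0 rmorph0.
  move/(eq_Znat (expl_gt1 l_prime _) _ 0%N); rewrite expn1 mod0n.
  by move/eqP.
have yP m : (y m.+1 : nat)%:R = y m.
  rewrite -[LHS]/(zred (y m.+1)) zred_natr.
  apply/(eq_Znat (expl_gt1 l_prime _))/eqn_mod_expS.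
  rewrite ![(l * (_ %/ _))%N]mulnC !divnK //.
  by apply/(eq_Znat (expl_gt1 l_prime _)); rewrite !zproj_nat_le.
exists (Padic yP); apply: padicP => m.
rewrite zprojM /= zproj_nat -natrM mulnC divnK //.
by rewrite zproj_nat_le.
Qed.

(** An integer prime to [l] is invertible modulo every power of [l], and the inverses are compatible
    because inverses are unique. *)
Lemma padic_inv x : red l_prime x != 0 -> exists y, x * y = 1.
Proof.
move=> x0.
have u m : (zproj x m : 'Z_(l ^ m.+1)) \is a GRing.unit.
  rewrite -[zproj x m]natr_Zp unitZpE ?expl_gt1 // coprimeXl //.
  rewrite prime_coprime //; apply: contra x0 => d.
  apply/eqP; rewrite -(rmorph0 (red l_prime)) -zproj_red zproj0.
  rewrite -(zproj_nat_le x (leq0n m)).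
  apply/(eq_Znat (expl_gt1 l_prime _) _ 0%N); rewrite expn1 mod0n.
  exact/eqP.
have yP m : zred (zproj x m.+1)^-1 = (zproj x m)^-1.
  apply: (mulrI (u m)); rewrite (divrr (u m)) -zred_proj.
  by rewrite -[LHS]zredM (divrr (u m.+1)) (zred_natr l m 1).
by exists (Padic yP); apply: padicP => m; exact: divrr (u m).
Qed.

(** Contraction principle: each application of [Phi] makes one more level independent of the
    starting point, beginning with level 0. *)
Lemma zproj_fixpoint (Phi : (nat -> padic l) -> nat -> padic l) :
    (forall a b i, zproj (Phi a i) 0 = zproj (Phi b i) 0) ->
    (forall m a b, (forall i, zproj (a i) m = zproj (b i) m) ->
       forall i, zproj (Phi a i) m.+1 = zproj (Phi b i) m.+1) ->
  exists a, Phi a = a.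
Proof.
(* With [m.+1] iterations, level [m] is already final. *)
move=> Phi0 PhiS; pose Z m := iter m.+1 Phi (fun=> 0).
have ZS m i : zproj (Z m.+1 i) m = zproj (Z m i) m.
  elim: m i => [|m IH] i; first exact: Phi0.
  exact: PhiS.
have ZP i m : ((zproj (Z m.+1 i) m.+1 : 'Z_(l ^ m.+2)) : nat)%:R
    = zproj (Z m i) m by rewrite zprojP ZS.
(* The fixed point is diagonal: its level [m] is that of [Z m]. *)
exists (fun i => Padic (ZP i)); apply: functional_extensionality_dep => i.
apply: padicP => -[|m] /=; first exact: Phi0.
exact: PhiS.
Qed.

End Residue.

(** * Formal power series over a commutative ring *)

Section PowerSeries.
Variable A : comNzRingType.
Implicit Types f g h u : nat -> A.

Definition fps_one n : A := (n == 0%N)%:R.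

(** This is the series [T^d f]. *)
Definition fps_shift d f n : A := if (n < d)%N then 0 else f (n - d)%N.

(** Truncation lets commutativity and associativity be inherited from polynomials. *)
Lemma fps_mul_poly f g N n : (n < N)%N ->
  fps_mul f g n = (\poly_(i < N) f i * \poly_(i < N) g i)`_n.
Proof.
move=> nN; rewrite coefM; apply: eq_bigr => i _; rewrite !coef_poly.
by rewrite (leq_ltn_trans (leq_subr _ _) nN) (leq_trans (ltn_ord i) nN).
Qed.

Lemma fps_mulC f g : fps_mul f g = fps_mul g f.
Proof. by apply/funext => n; rewrite !(@fps_mul_poly _ _ n.+1) // mulrC. Qed.

Lemma fps_mulA f g h : fps_mul f (fps_mul g h) = fps_mul (fps_mul f g) h.
Proof.
apply/funext => n; pose P k := \poly_(i < n.+1) (k i : A).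
transitivity ((P f * P g * P h)`_n).
  rewrite -mulrA coefM; apply: eq_bigr => i _; rewrite coef_poly ltn_ord.
  by rewrite -fps_mul_poly // ltnS leq_subr.
rewrite coefM; apply: eq_bigr => i _; rewrite coef_poly ltnS leq_subr.
by rewrite -fps_mul_poly.
Qed.

Lemma fps_mul1 f : fps_mul f fps_one = f.
Proof.
apply/funext => n; rewrite /fps_mul big_ord_recr /= subnn /fps_one mulr1.
by rewrite big1 ?add0r // => i _; rewrite subn_eq0 leqNgt ltn_ord mulr0.
Qed.

Lemma fps_mul_shift d f g :
  fps_mul (fps_shift d f) g = fps_shift d (fps_mul f g).
Proof.
apply/funext => n; rewrite {2}/fps_shift; case: ltnP => [nd|dn].
  apply: big1 => i _; rewrite /fps_shift ifT ?mul0r //.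
  by rewrite (leq_ltn_trans _ nd) // -ltnS.
rewrite /fps_mul -!(big_mkord xpredT (fun i => _ i * g (_ - i)%N)).
rewrite (big_cat_nat (n := d)) //=; last by rewrite (leq_trans dn).
rewrite big_nat big1 ?add0r => [|i /andP[_ id]]; last first.
  by rewrite /fps_shift id mul0r.
rewrite -{1}[d]add0n big_addn subSn //; apply: eq_bigr => i _.
by rewrite /fps_shift ltnNge leq_addl /= addnK addnC subnDA.
Qed.

(** The coefficient of [T^n] in [u v = 1] is solved for [v n], with [c] as the inverse of the
    constant term. Each [v n] uses all earlier ones, hence the well-founded recursion. *)
Lemma fps_inv u c : u 0%N * c = 1 -> exists v, fps_mul u v = fps_one.
Proof.
move=> uc.
pose F n (rec : forall m, (m < n)%coq_nat -> A) : A :=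
  c * (fps_one n - \sum_(i < n) rec i (ssrnat.ltP (ltn_ord i)) * u (n - i)%N).
pose v := Fix Wf_nat.lt_wf (fun=> A) F.
have vE n : v n = c * (fps_one n - \sum_(i < n) v i * u (n - i)%N).
  rewrite /v Fix_eq // => m f g fg.
  by congr (_ * (_ - _)); apply: eq_bigr => i _; rewrite fg.
exists v; rewrite fps_mulC; apply/funext => n.
by rewrite /fps_mul big_ord_recr /= subnn vE mulrAC [c * _]mulrC uc mul1r
  addrC subrK.
Qed.

End PowerSeries.

(** * Weierstrass factorisations and how the first unit coefficient determines them *)

Section Weierstrass.
Variables (l : nat) (l_prime : prime l).
Local Notation red := (red l_prime).
Implicit Types (f u : nat -> padic l) (g : {poly padic l}).

Lemma fps_unit_red u : fps_unit u <-> red (u 0%N) != 0.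
Proof.
split=> [[v /(congr1 (fun w => red (w 0%N)))]|/padic_inv[c]].
  rewrite /fps_mul big_ord1 rmorphM rmorph1 /= => uv.
  by apply: contra_eq_neq uv => ->; rewrite mul0r eq_sym oner_eq0.
exact: fps_inv.
Qed.

(** Modulo [l], a distinguished polynomial of degree [d] is just [T^d]. *)
Lemma distinguished_mul_unit g u d : distinguished g -> size g = d.+1 ->
  forall n, red (fps_mul (fun i => g`_i) u n) =
    fps_shift d (fun i => red (u i)) n.
Proof.
move=> [gm gl] gd n.
have -> : red (fps_mul (fun i => g`_i) u n) =
    fps_mul (fun i => red g`_i) (fun i => red (u i)) n.
  by rewrite rmorph_sum; apply: eq_bigr => i _; rewrite rmorphM.
have -> : (fun i => red g`_i) = fps_shift d (fps_one _).
  apply/funext => i; rewrite /fps_shift /fps_one subn_eq0; case: ltngtP => id.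
  - by apply/ldvdP/gl; rewrite gd.
  - by rewrite nth_default ?rmorph0 // gd.
  by rewrite id -[d]/(d.+1.-1) -gd -/(lead_coef g) (monicP gm) rmorph1.
by rewrite fps_mul_shift fps_mulC fps_mul1.
Qed.

(** A positive [mu] would kill every coefficient modulo [l]. With [mu = 0], the reduction of [f] is
    [T^(deg g)] times a unit, so its first nonzero coefficient sits at index [deg g]. *)
Lemma weierstrass_uniq f mu g u n : weierstrass f mu g u ->
    (forall i, (i < n)%N -> red (f i) = 0) -> red (f n) != 0 ->
  mu = 0%N /\ (size g).-1 = n.
Proof.
move=> [dg /fps_unit_red u0 fE] f0 fn.
have mu0 : mu = 0%N.
  case: mu fE fn => // mu ->.
  by rewrite rmorphM rmorphXn rmorph_nat (pcharf0 (pchar_Fp l_prime)) exprS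
    !mul0r eqxx.
split=> //; have gd : size g = (size g).-1.+1.
  by rewrite prednK // size_poly_gt0 monic_neq0 //; case: dg.
have fE' i : red (f i) = fps_shift (size g).-1 (fun j => red (u j)) i.
  by rewrite fE mu0 mul1r (distinguished_mul_unit _ dg gd).
apply/eqP; rewrite eqn_leq leqNgt andbC leqNgt; apply/andP; split.
  by apply/negP => /f0; rewrite fE' /fps_shift ltnn subnn; apply/eqP.
by apply: contra fn; rewrite fE' /fps_shift => ->.
Qed.

(* Writing f = l P + T^n U with U a unit, the quotient q with f q polynomial is
   Z / U, where Z is the fixed point of the l-adic contraction
   Z |-> 1 - l tau (P Z / U) and tau drops the coefficients of index < n. *)
Lemma weierstrass_preparation f n :
    (forall i, (i < n)%N -> red (f i) = 0) -> red (f n) != 0 ->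
  exists g u, weierstrass f 0 g u.
Proof.
move=> f0 fn.
have [p pE] : exists p, forall i, (i < n)%N -> f i = l%:R * p i.
  suff /choice[p pE] : forall i, exists y, (i < n)%N -> f i = l%:R * y.
    by exists p.
  move=> i; case: (ltnP i n) => [/f0/ldvdP[y]|_]; first by exists y.
  by exists 0.
pose P i := if (i < n)%N then p i else 0; pose U i := f (n + i)%N.
have fE : f = (fun i => l%:R * P i + fps_shift n U i).
  apply/funext => i; rewrite /P /fps_shift /U.
  by case: ltnP => [/pE->|/subnKC->]; rewrite ?addr0 // mulr0 add0r.
have [V UV] : exists V, fps_mul U V = fps_one _.
  by apply/fps_unit_red; rewrite /U addn0.
pose W := fps_mul P V.
(* [W] is [P / U]; reading it at index [n + i] drops the coefficients below [n] and shifts the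
   others down. *)
pose Phi (Z : nat -> padic l) i : padic l :=
  fps_one _ i - l%:R * fps_mul W Z (n + i)%N.
have [Z ZE] : exists Z, Phi Z = Z.
  apply: zproj_fixpoint => [a b i|m a b ab i]; rewrite !zprojD !zprojN.
    by rewrite !zproj_natl0.
  congr (_ - _); apply: zproj_natl => //.
  rewrite !(big_morph (fun x : padic l => zproj x m)
    (fun x y => zprojD x y m) (zproj0 l m)).
  by apply: eq_bigr => j _; rewrite !zprojM ab.
pose q := fps_mul V Z; pose r i := l%:R * fps_mul W Z i.
have fq : fps_mul f q = (fun i => r i + fps_shift n Z i).
  have -> : fps_mul f q = fun i => l%:R * fps_mul P q i
      + fps_mul (fps_shift n U) q i.
    apply/funext => i; rewrite mulr_sumr -big_split /=; apply: eq_bigr => j _.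
    by rewrite fE mulrDl mulrA.
  by rewrite fps_mul_shift /q !fps_mulA UV (fps_mulC (fps_one _)) fps_mul1.
pose g : {poly padic l} := 'X^n + \poly_(i < n) r i.
(* In degree [n + i] the product is [r (n + i) + Z i], which the fixed-point equation turns into 1
   for [i = 0] and 0 for [i > 0]. *)
have gE : fps_mul f q = (fun i => g`_i).
  rewrite fq; apply/funext => i; rewrite coefD coefXn coef_poly /fps_shift.
  case: ltngtP => [_|ni|->]; first by rewrite add0r addr0.
    rewrite -ZE /Phi /r subnKC ?(ltnW ni) // addrC subrK addr0.
    by rewrite /fps_one subn_eq0 leqNgt ni.
  by rewrite subnn -ZE /Phi addn0 addrC subrK addr0.
have gs : size g = n.+1.
  by rewrite size_polyDl size_polyXn // ltnS size_poly.
(* The constant term of [q] is [V 0 * Z 0], where [V 0] is a unit and [Z 0] is 1 modulo [l]. *)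
have [v qv] : exists v, fps_mul q v = fps_one _.
  apply/fps_unit_red; rewrite /q /fps_mul big_ord1 rmorphM mulf_eq0 negb_or.
  apply/andP; split.
    by apply/fps_unit_red; exists U; rewrite fps_mulC.
  rewrite -ZE /Phi rmorphB rmorphM /= rmorph1 rmorph_nat.
  by rewrite (pcharf0 (pchar_Fp l_prime)) mul0r subr0 oner_eq0.
exists g, v; split.
- split; last first.
    move=> i; rewrite gs => lt; rewrite coefD coefXn coef_poly lt ltn_eqF //.
    by rewrite add0r; exists (fps_mul W Z i).
  by rewrite monicE lead_coefE gs coefD coefXn coef_poly eqxx ltnn addr0.
- by exists q; rewrite fps_mulC.
by apply/funext => i; rewrite mul1r -gE -fps_mulA qv fps_mul1.
Qed.

(** Existence excludes the default of [xget]; uniqueness then applies to whichever factorisation was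
    chosen. *)
Lemma weierstrass_dataE f n :
    (forall i, (i < n)%N -> red (f i) = 0) -> red (f n) != 0 ->
  (weierstrass_data f).1 = 0%N /\ (size (weierstrass_data f).2).-1 = n.
Proof.
move=> f0 fn; have [g [u fgu]] := weierstrass_preparation f0 fn.
have [|v fv] := @xgetPex _ (1%N, 1) [set p | exists u, weierstrass f p.1 p.2 u].
  by exists (0%N, g), u.
exact: weierstrass_uniq fv f0 fn.
Qed.

End Weierstrass.

(** * Zeros of [x^2 + y^2] over a prime field *)

Section SumOfTwoSquares.
Variables (p : nat) (p_prime : prime p) (p_gt2 : (2 < p)%N).
Implicit Types x y : 'F_p.

Lemma F2_neq0 : 2%:R != 0 :> 'F_p.
Proof. by rewrite -(dvdn_pcharf (pchar_Fp p_prime)) gtnNdvd. Qed.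

Let N1_neq1 : -1 != 1 :> 'F_p.
Proof. by rewrite eq_sym -addr_eq0 F2_neq0. Qed.

Lemma Fp_fermat x : x != 0 -> x ^+ p.-1 = 1.
Proof.
move=> x0; apply: (mulIf x0); rewrite mul1r -exprSr prednK ?prime_gt0 //.
by have := expf_card x; rewrite card_Fp.
Qed.

(** With [p - 1 = 4k], the [4k] nonzero elements cannot all be roots of [X^(2k) - 1]. If [x] is not
    a root, then [x^(2k)] squares to 1 and differs from 1, so it is -1 and [x^k] is the desired
    root. *)
Lemma Fp_sqrtN1 : p = 1 %[mod 4] -> exists i : 'F_p, i ^+ 2 = -1.
Proof.
move=> pE; have {pE} p1 : (p %% 4 = 1)%N by []; pose k := (p %/ 4)%N.
have pE : p.-1 = (k * 2 * 2)%N.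
  by rewrite {1}(divn_eq p 4) p1 addn1 -mulnA.
have k0 : (0 < k)%N.
  rewrite lt0n; apply: contraL p_gt2 => /eqP k0.
  by rewrite (divn_eq p 4) -/k k0 p1.
have [x x0 xk] : exists2 x : 'F_p, x != 0 & x ^+ (k * 2) != 1.
  apply: contrapT => /forall2NP all1.
  have := @max_unity_roots 'F_p (k * 2) (enum [set~ (0 : 'F_p)]%SET).
  rewrite muln_gt0 k0 enum_uniq -cardE cardsC1 card_Fp // pE.
  rewrite -{3}[(k * 2)%N]muln1 leq_pmul2l ?muln_gt0 ?k0 //.
  move=> /(_ isT _ isT) le21; suff : (2 <= 1)%N by []; apply: le21.
  apply/allP => x; rewrite mem_enum !inE => x0; apply/unity_rootP/eqP.
  by case: (all1 x) => /negP; rewrite ?x0 // negbK.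
exists (x ^+ k); rewrite -exprM; apply/eqP; move: xk; rewrite -addr_eq0.
have : (x ^+ (k * 2) - 1) * (x ^+ (k * 2) + 1) == 0.
  by rewrite -subr_sqr -exprM -pE Fp_fermat // expr1n subrr.
by rewrite mulf_eq0 subr_eq0 => /orP[->|].
Qed.

(** Otherwise [z = x / y] has square -1. Since [(p - 1) / 2] is odd, [z^(p - 1) = -1], against
    Fermat. *)
Lemma sum2sq_Fp_3mod4 x y : p = 3 %[mod 4] -> x ^+ 2 + y ^+ 2 = 0 -> y = 0.
Proof.
move=> pE; have {pE} p3 : (p %% 4 = 3)%N by [].
move=> xy; apply/eqP; apply: contraT => y0.
pose k := (p %/ 4)%N.
have pE : p.-1 = (2 * (k * 2).+1)%N.
  by rewrite {1}(divn_eq p 4) p3 addn3 /= [RHS]mulnS [(2 * (k * 2))%N]mulnCA.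
have z2 : (x / y) ^+ 2 = -1.
  apply: (mulIf (expf_neq0 2 y0)); rewrite exprMn exprVn mulfVK ?expf_neq0 //.
  by apply/eqP; rewrite mulN1r -addr_eq0 xy.
have z0 : x / y != 0.
  by rewrite -sqrf_eq0 z2 oppr_eq0 oner_eq0.
have := Fp_fermat z0; rewrite pE exprM z2 exprS mulnC exprM sqrrN !expr1n mulr1.
by move/eqP; rewrite (negPf N1_neq1).
Qed.

Lemma card_sum2sq_Fp : p = 1 %[mod 4] ->
  #|[set r : 'rV['F_p]_2 | r != 0 & \sum_(j < 2) r ord0 j ^+ 2 == 0]%SET|
    = (2 * p.-1)%N.
Proof.
case/Fp_sqrtN1 => i i2.
have i0 : i != 0 by rewrite -sqrf_eq0 i2 oppr_eq0 oner_eq0.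
(* The zeros form the two lines [y = i x] and [y = - i x]; the boolean is the sign. For [x] nonzero
   the parametrisation is injective. *)
pose h (xe : 'F_p * bool) : 'rV['F_p]_2 :=
  \row_j (if j == ord0 then xe.1 else (-1) ^+ xe.2 * i * xe.1).
have -> : [set r : 'rV['F_p]_2 | r != 0 & \sum_(j < 2) r ord0 j ^+ 2 == 0]%SET
    = (h @: finset.setX [set~ 0] [set: bool])%SET.
  apply/setP => r; rewrite finset.in_set.
  apply/andP/imsetP => [[r0]|[[x e]]]; last first.
    rewrite finset.in_setX finset.in_setC1 andbC => /andP[_ x0] ->; split.
      by apply: contra x0 => /eqP/rowP/(_ ord0); rewrite !mxE /= => ->.
    rewrite !big_ord_recl big_ord0 !mxE /= addr0 !exprMn i2 -exprM mulnC exprM.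
    by rewrite sqrrN !expr1n mul1r mulN1r subrr.
  rewrite !big_ord_recl big_ord0 addr0; set x := r _ _; set y := r _ _ => xy.
  have ye : exists e : bool, y = (-1) ^+ e * i * x.
    have : (y - i * x) * (y + i * x) == 0.
      by rewrite -subr_sqr exprMn i2 mulN1r opprK addrC.
    rewrite mulf_eq0 subr_eq0 addr_eq0 => /orP[] /eqP ->.
      by exists false; rewrite mul1r.
    by exists true; rewrite mulN1r mulNr.
  case: ye => e ye; exists (x, e).
    rewrite finset.in_setX finset.in_setC1 finset.in_setT andbT.
    apply: contra r0 => /eqP x0.
    apply/eqP/rowP => j; rewrite [RHS]mxE.
    by case: (unliftP ord0 j) => [k ->|-> //]; rewrite ord1 -/y ye x0 mulr0.
  apply/rowP => j; rewrite mxE.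
  by case: (unliftP ord0 j) => [k ->|-> //]; rewrite ord1.
rewrite card_in_imset.
  by rewrite cardsX cardsC1 (card_Fp p_prime) cardsT card_bool mulnC.
move=> [x e] [x' e']; rewrite !finset.in_setX !finset.in_setC1.
move=> /andP[/= x0 _] _ /rowP hh.
have := hh (lift ord0 ord0); have := hh ord0; rewrite !mxE /= => <-.
move=> /(mulIf x0)/(mulIf i0) ee; congr (_, _); move: ee {hh}.
case: e e' => -[] // /eqP; rewrite ?(negPf N1_neq1) //.
by rewrite eq_sym (negPf N1_neq1).
Qed.

End SumOfTwoSquares.

(** * Low-degree coefficients of the characteristic series *)

Section CharSeries.
Variables (l : nat) (l_prime : prime l).
Local Notation red := (red l_prime).
Implicit Types (b : padic l).

(** In degrees 0 to 3, [binom_uniq] cancels [n!], which leaves a polynomial identity in [b]. *)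
Lemma binom_symm0 b : binom b 0 + binom (- b) 0 = 2.
Proof.
apply: (binom_uniq l_prime (n := 0)).
by rewrite mulrDr !binomP // !big_ord0 fact0 mul1r.
Qed.

Lemma binom_symm1 b : binom b 1 + binom (- b) 1 = 0.
Proof.
apply: (binom_uniq l_prime (n := 1)).
by rewrite mulrDr !binomP // !big_ord1 /= mulr0; ring.
Qed.

Lemma binom_symm2 b : binom b 2 + binom (- b) 2 = b ^+ 2.
Proof.
apply: (binom_uniq l_prime (n := 2)).
rewrite mulrDr !binomP // !big_ord_recl !big_ord0 /= /bump /= -[2`!]/2%N.
by ring.
Qed.

Lemma binom_symm3 b : binom b 3 + binom (- b) 3 = - b ^+ 2.
Proof.
apply: (binom_uniq l_prime (n := 3)).
rewrite mulrDr !binomP // !big_ord_recl !big_ord0 /= /bump /= -[3`!]/6%N.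
by ring.
Qed.

(** The closed form [(b^4 + 11 b^2) / 12] has a denominator divisible by 3, so the factor [4!] is
    kept. *)
Lemma binom_symm4 b :
  4`!%:R * (binom b 4 + binom (- b) 4) = 2 * b ^+ 4 + 22 * b ^+ 2.
Proof.
by rewrite mulrDr !binomP // !big_ord_recl !big_ord0 /= /bump /=; ring.
Qed.

Lemma char_seriesE t (alpha : 'rV[padic l]_t) n : char_series alpha n =
  \sum_(j < t) (2 * (n == 0)%:R
    - (binom (alpha ord0 j) n + binom (- alpha ord0 j) n)).
Proof. by apply: eq_bigr => j _; rewrite opprD addrA. Qed.

Lemma char_series0 t (alpha : 'rV[padic l]_t) : char_series alpha 0 = 0.
Proof.
by rewrite char_seriesE big1 // => j _; rewrite binom_symm0 mulr1 subrr.
Qed.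

Lemma char_series1 t (alpha : 'rV[padic l]_t) : char_series alpha 1 = 0.
Proof.
by rewrite char_seriesE big1 // => j _; rewrite binom_symm1 mulr0 subrr.
Qed.

Lemma char_series2 t (alpha : 'rV[padic l]_t) :
  char_series alpha 2 = - \sum_(j < t) alpha ord0 j ^+ 2.
Proof.
rewrite char_seriesE -sumrN; apply: eq_bigr => j _.
by rewrite binom_symm2 mulr0 sub0r.
Qed.

Lemma char_series3 t (alpha : 'rV[padic l]_t) :
  char_series alpha 3 = \sum_(j < t) alpha ord0 j ^+ 2.
Proof.
rewrite char_seriesE; apply: eq_bigr => j _.
by rewrite binom_symm3 mulr0 sub0r opprK.
Qed.

Lemma char_series4 t (alpha : 'rV[padic l]_t) : 4`!%:R * char_series alpha 4 =
  - (2 * \sum_(j < t) alpha ord0 j ^+ 4 + 22 * \sum_(j < t) alpha ord0 j ^+ 2).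
Proof.
rewrite char_seriesE !mulr_sumr -big_split -sumrN; apply: eq_bigr => j _.
by rewrite mulr0 sub0r mulrN binom_symm4.
Qed.

Definition residue t (alpha : 'rV[padic l]_t) : 'rV['F_l]_t := map_mx red alpha.

Lemma admissibleP t (alpha : 'rV[padic l]_t) :
  admissible alpha <-> residue alpha != 0.
Proof.
split=> [adm|/eqP n0 ldv].
  apply/eqP => /rowP r0; apply: adm => j; apply/(ldvdP l_prime).
  by have := r0 j; rewrite !mxE.
apply: n0; apply/rowP => j; rewrite !mxE; exact/ldvdP/ldv.
Qed.

Lemma bouquet2_invariants (alpha : 'rV[padic l]_2) (r := residue alpha) :
  (2 < l)%N -> admissible alpha ->
  mu_inv alpha = 0%N /\
  lambda_inv alpha = if \sum_(j < 2) r ord0 j ^+ 2 == 0 then 3 else 1.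
Proof.
move=> l2 /admissibleP; rewrite -/r => r0.
have redS k : red (\sum_(j < 2) alpha ord0 j ^+ k) = \sum_(j < 2) r ord0 j ^+ k.
  by rewrite rmorph_sum; apply: eq_bigr => j _; rewrite rmorphXn !mxE.
rewrite /mu_inv /lambda_inv; case: ifPn => [/eqP s0|sn0]; last first.
  have [||-> ->] // := weierstrass_dataE (l_prime := l_prime)
    (f := char_series alpha) (n := 2).
  - by move=> [|[|]] // _; rewrite ?char_series0 ?char_series1 rmorph0.
  - by rewrite char_series2 rmorphN oppr_eq0 /= redS.
have [||-> ->] // := weierstrass_dataE (l_prime := l_prime)
  (f := char_series alpha) (n := 4).
  move=> [|[|[|[|]]]] // _; rewrite ?char_series0 ?char_series1 ?rmorph0 //.
    by rewrite char_series2 rmorphN /= redS s0 oppr0.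
  by rewrite char_series3 redS.
(* If [l] divided [f_4] it would divide [4! f_4], hence [4 x^4], forcing [x = y = 0]. As nothing is
   divided by [4!], this covers [l = 3] too. *)
apply/eqP => c0; have := congr1 red (char_series4 alpha).
rewrite rmorphM /= c0 mulr0 rmorphN rmorphD !rmorphM /= !redS s0 mulr0 addr0.
rewrite rmorph_nat.
move: s0 r0; rewrite !big_ord_recl !big_ord0 !addr0.
set x := r _ _; set y := r _ _ => s0 r0 /esym/eqP.
have y2 : y ^+ 2 = - x ^+ 2 by apply/eqP; rewrite -addr_eq0 addrC s0.
rewrite oppr_eq0 -[4%N]/(2 * 2)%N !exprM y2 sqrrN.
rewrite -mulr2n -[_ ^+ 2 *+ 2]mulr_natl.
rewrite !mulf_eq0 (negPf (F2_neq0 l_prime l2)) /= !orbb => /eqP x0; case/eqP: r0.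
have y0 : y = 0 by apply/eqP; rewrite -sqrf_eq0 y2 x0 expr0n oppr0.
apply/rowP => j; rewrite [RHS]mxE.
by case: (unliftP ord0 j) => [k ->|-> //]; rewrite ord1.
Qed.

End CharSeries.

(** * Haar measure of unions of residue classes modulo [l] *)

Section Haar.
Variables (l : nat) (l_prime : prime l) (t : nat) (R : realType).
Variables (tau : probability (borel_padic l t) R) (tau_haar : is_haar tau).
Local Notation residue := (residue l_prime).

Lemma residue_surj (r : 'rV['F_l]_t) : exists a : 'rV[padic l]_t, residue a = r.
Proof.
exists (\row_j (r ord0 j : nat)%:R); apply/rowP => j.
by rewrite !mxE rmorph_nat natr_Zp.
Qed.

Definition residue_class (r : 'rV['F_l]_t) : set (borel_padic l t) :=
  [set alpha : 'rV[padic l]_t | residue alpha = r].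

Lemma measurable_residue_class r : measurable (residue_class r).
Proof.
apply: sub_sigma_algebra; rewrite openE => a ar /=.
(* The class is open: it contains, around each point, a product of level-0 balls. *)
exists (fun i j => [set y | zproj y 0 = zproj (a i j) 0]).
  move=> i j; apply: open_nbhs_nbhs; split=> //.
  by move=> x <-; exists 0%N.
move=> b ab /=; rewrite -ar; apply/rowP => j; rewrite !mxE.
exact/zproj_red/ab.
Qed.

(** Translation by a lift of [r] carries the zero class onto the class of [r]. *)
Lemma haar_residue_class r : tau (residue_class r) = tau (residue_class 0).
Proof.
have [a ar] := residue_surj r.
rewrite -(tau_haar a (measurable_residue_class 0)); congr (tau _).
have resD (x y : 'rV[padic l]_t) : residue (x + y) = residue x + residue y.
  exact: map_mxD.
apply/seteqP; split=> [b br|_ [b b0 <-]].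
  exists (b - a); last by rewrite addrC subrK.
  by apply: (addIr (residue a)); rewrite -resD subrK br ar add0r.
by rewrite /residue_class /= resD b0 addr0.
Qed.

Lemma haar_residue (P : pred 'rV['F_l]_t) :
  tau [set alpha : 'rV[padic l]_t | P (residue alpha)] =
    (#|P|%:R / l%:R ^+ t)%:E.
Proof.
have sumE (Q : pred 'rV['F_l]_t) :
    tau [set alpha : 'rV[padic l]_t | Q (residue alpha)] =
    (#|Q|%:R * fine (tau (residue_class 0)))%:E.
  have -> : [set alpha : 'rV[padic l]_t | Q (residue alpha)] =
      \bigcup_(r in [set` enum Q]) residue_class r.
    apply/seteqP; split=> [a Qa|a [r /= Qr ar]].
      by exists (residue a) => //=; rewrite mem_enum.
    by rewrite mem_enum -(ar : residue a = r) in Qr.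
  rewrite measure_fin_bigcup //=.
  - rewrite -fsbig_seq ?enum_uniq //.
    rewrite (eq_bigr _ (fun r _ => haar_residue_class r)).
    rewrite big_const_seq count_predT -cardE iter_addr_0.
    rewrite EFinM fineK ?fin_num_measure //; first last.
      exact: measurable_residue_class.
    by rewrite mule_natl.
  - by move=> r s _ _ [a [ar as_]]; rewrite -[r]ar -[s]as_.
  - by move=> r _; exact: measurable_residue_class.
(* The common mass of a class is found from the whole space: [l^t] classes of total mass 1. *)
have := sumE predT.
have -> : [set alpha : 'rV[padic l]_t | predT (residue alpha)] = setT.
  by apply/seteqP; split.
rewrite probability_setT card_mx card_Fp // mul1n natrX => -[tE].
rewrite sumE; congr (_%:E); congr (_ * _).
have l0 : l%:R ^+ t != 0 :> R.
  by rewrite expf_neq0 // pnatr_eq0 -lt0n prime_gt0.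
by apply: (mulfI l0); rewrite divff.
Qed.

End Haar.

(** * From counts of residues to probabilities *)

Unset Implicit Arguments.

Theorem proposition4p19 (l : nat) (l_prime : prime l) (l_ge3 : (3 <= l)%N) :
  [/\ forall alpha : 'rV[padic l]_2, admissible alpha -> mu_inv alpha = 0%N,
      l = 3 %[mod 4] ->
        forall alpha : 'rV[padic l]_2, admissible alpha -> lambda_inv alpha = 1
    & l = 1 %[mod 4] ->
        forall (R : realType) (tau : probability (borel_padic l 2) R),
          is_haar tau ->
          forall lambda0 : int,
            Prob tau 0 lambda0 =
              if lambda0 == 1 then (l%:R - 1) / (l%:R + 1)
              else if lambda0 == 3 then 2 / (l%:R + 1)
              else 0].
Proof.
have s_neq0 (alpha : 'rV[padic l]_2) : admissible alpha -> l = 3 %[mod 4] ->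
    \sum_(j < 2) residue l_prime alpha ord0 j ^+ 2 != 0.
  move=> /(admissibleP l_prime); set r := residue _ _ => r0 l3.
  apply: contra r0; rewrite !big_ord_recl big_ord0 addr0 => /eqP s0.
  apply/eqP/rowP => j; rewrite [RHS]mxE.
  case: (unliftP ord0 j) => [k ->|->].
    by rewrite ord1; exact: sum2sq_Fp_3mod4 s0.
  by rewrite addrC in s0; exact: sum2sq_Fp_3mod4 s0.
split=> [alpha adm|l3 alpha adm|l1 R tau tau_haar lambda0].
- by have [] := bouquet2_invariants l_prime l_ge3 adm.
- have [_ ->] := bouquet2_invariants l_prime l_ge3 adm.
  by rewrite (negPf (s_neq0 _ _ _)).
pose s (r : 'rV['F_l]_2) := \sum_(j < 2) r ord0 j ^+ 2.
pose P (r : 'rV['F_l]_2) :=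
  (r != 0) && ((if s r == 0 then 3 else 1 : int) == lambda0).
(* Since [mu = 0] holds throughout, the event is the preimage of [P] under reduction. *)
have -> : Prob tau 0 lambda0 = (1 - (l%:R ^+ 2)^-1)^-1 * (#|P|%:R / l%:R ^+ 2).
  rewrite /Prob; congr (_ * _).
  rewrite -[RHS]/(fine _%:E) -(haar_residue l_prime tau_haar).
  congr (fine (tau _)); apply/seteqP; split=> alpha /=.
    case=> adm _; rewrite /P => <-.
    have [_ ->] := bouquet2_invariants l_prime l_ge3 adm.
    by apply/andP; split=> //; apply/admissibleP.
  case/andP => /admissibleP adm /eqP <-.
  by have [] := bouquet2_invariants l_prime l_ge3 adm.
pose Q := [pred r : 'rV['F_l]_2 | r != 0 & s r == 0].
pose Q' := [pred r : 'rV['F_l]_2 | r != 0 & s r != 0].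
have card3 : #|Q| = (2 * l.-1)%N.
  rewrite -(card_sum2sq_Fp l_prime l_ge3 l1).
  by apply: eq_card => r; rewrite !inE.
(* [Q] and [Q'] partition the [l^2 - 1] nonzero vectors. *)
have card1 : (#|Q'| + 2 * l.-1 = (l ^ 2).-1)%N.
  rewrite -card3 addnC.
  have := cardC1 (0 : 'rV['F_l]_2); rewrite card_mx card_Fp // => <-.
  rewrite -(cardID [pred r | s r == 0] (predC1 0)).
  by congr (_ + _)%N; apply: eq_card => r; rewrite !inE // andbC.
have l_gt0 := prime_gt0 l_prime.
have l1E : l.-1%:R = l%:R - 1 :> R by rewrite -subn1 natrB.
have lD1 : l%:R + 1 != 0 :> R by rewrite natr1 pnatr_eq0.
have lB1 : l%:R - 1 != 0 :> R by rewrite subr_eq0 pnatr_eq1 gtn_eqF ?prime_gt1.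
have l0 : l%:R != 0 :> R by rewrite pnatr_eq0 -lt0n.
(* The [l^2] here cancels the one in the measure, so the probability is [#|P|] divided by
   [(l - 1) (l + 1)]. *)
have c0 : 1 - (l%:R ^+ 2)^-1 =
    (l%:R - 1) * (l%:R + 1) / l%:R ^+ 2 :> R by field.
rewrite c0.
have [lam1|lam1] := eqVneq lambda0 1.
  (* [(l^2 - 1) - 2 (l - 1) = (l - 1)^2]. *)
  have -> : #|P|%:R = (l%:R - 1) ^+ 2 :> R.
    have -> : #|P| = #|Q'|.
      by apply: eq_card => r; rewrite unfold_in !inE /P lam1; case: (s r == 0).
    move/(congr1 (fun n => n%:R : R)): card1.
    rewrite natrD natrM l1E -subn1 natrB ?expn_gt0 ?l_gt0 // natrX => e.
    by apply: (addIr (2 * (l%:R - 1))); rewrite [LHS]e; ring.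
  by field; apply/and3P.
have [lam3|lam3] := eqVneq lambda0 3.
  have -> : #|P| = #|Q|.
    by apply: eq_card => r; rewrite unfold_in !inE /P lam3; case: (s r == 0).
  by rewrite card3 natrM l1E; field; apply/and3P.
have -> : #|P| = 0%N.
  apply: eq_card0 => r; rewrite unfold_in /P; case: ifP => _.
    by rewrite [_ == lambda0]eq_sym (negPf lam3) andbF.
  by rewrite [_ == lambda0]eq_sym (negPf lam1) andbF.
by rewrite mul0r mulr0.
Qed.
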